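(* Let $M$ be a countable set and let $G \leq \mathrm{Sym}(M)$ be a permutation group such that for every $a \in M$, the orbits of the stabilizer $G_a$ on $M \setminus \{a\}$ are infinite. Let $(\xi_a : a \in M)$ be random variables whose joint distribution is $G$-invariant. Then the random variables $(\xi_a : a\in M)$ are conditionally independent over the tail $\sigma$-field $\mathcal{T}_0$.
   Context: The random variables $\xi_a$ are defined on a common probability space and take values in a common Polish space (e.g. $[0,1]$). Their joint distribution is $G$-invariant if for every $g \in G$ the families $(\xi_{g\cdot a})_{a \in M}$ and $(\xi_a)_{a\in M}$ have the same distribution. The tail $\sigma$-field is $\mathcal{T}_0 = \bigcap \{ \langle \xi_a : a \in M\setminus A\rangle : A \subseteq M \text{ finite}\}$, where $\langle \cdot \rangle$ denotes the generated $\sigma$-field (events are considered modulo null sets). *)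

(* Defs.v *)
From HB Require Import structures.
From mathcomp Require Import all_boot all_order all_algebra finmap.
From mathcomp Require Import all_classical all_reals all_analysis.

Set Implicit Arguments.
Unset Strict Implicit.
Unset Printing Implicit Defensive.

Import Order.TTheory GRing.Theory Num.Theory.
Import numFieldNormedType.Exports.

Local Open Scope classical_set_scope.
Local Open Scope ring_scope.

Definition permutation_group (M : Type) (G : set (M -> M)) : Prop :=
  [/\ forall g, G g -> bijective g,
      G id,
      forall g h, G g -> G h -> G (g \o h) &
      forall g h, G g -> cancel g h -> cancel h g -> G h].

Definition stabilizer (M : Type) (G : set (M -> M)) (a : M) : set (M -> M) :=
  [set g | G g /\ g a = a].

Definition orbit_of (M : Type) (H : set (M -> M)) (b : M) : set M :=
  [set g b | g in H].

Definition polish_space (R : realType) (S : topologicalType) : Prop :=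
  (exists2 D : set S, countable D & dense D) /\
  exists (K : metricType R) (f : S -> K) (h : K -> S),
    [/\ cancel f h, cancel h f, continuous f, continuous h &
        forall F : set_system K, ProperFilter F -> cauchy F ->
          exists l : K, F --> l].

Notation borel S := (g_sigma_algebraType (@open S)).

Definition sigma_gen (M T : Type) d (S : measurableType d)
    (xi : M -> T -> S) (D : set M) : set (set T) :=
  <<s \bigcup_(a in D) preimage_set_system setT (xi a) measurable >>.

(* The product sigma-field on M -> S is the one generated by the coordinate
   maps. *)
Definition same_distribution (M : Type) d (T : measurableType d)
    (R : realType) (P : probability T R) d' (S : measurableType d')
    (xi eta : M -> T -> S) : Prop :=
  forall C : set (M -> S), sigma_gen (fun a (x : M -> S) => x a) setT C ->
    P ((fun t a => xi a t) @^-1` C) = P ((fun t a => eta a t) @^-1` C).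

Definition invariant_distribution (M : Type) (G : set (M -> M))
    d (T : measurableType d) (R : realType) (P : probability T R)
    d' (S : measurableType d') (xi : M -> T -> S) : Prop :=
  forall g, G g -> same_distribution P (fun a => xi (g a)) xi.

Definition modulo_null d (T : measurableType d) (R : realType)
    (P : probability T R) (F : set (set T)) : set (set T) :=
  [set E | measurable E /\ exists2 E', F E' & P (E `+` E') = 0%E].

Definition tail_sigma (M : Type) d (T : measurableType d) (R : realType)
    (P : probability T R) d' (S : measurableType d') (xi : M -> T -> S) :
    set (set T) :=
  \bigcap_(A in [set A : set M | finite_set A])
    modulo_null P (sigma_gen xi (~` A)).

(* f is a version of the conditional probability P(E | F); the sigma-field of
   g_sigma_algebraType F is F itself as soon as F is a sigma-field. *)
Definition is_cond_prob d (T : measurableType d) (R : realType)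
    (P : probability T R) (F : set (set T)) (E : set T) (f : T -> R) : Prop :=
  [/\ measurable_fun setT (f : g_sigma_algebraType F -> R),
      P.-integrable setT (EFin \o f) &
      forall C, F C -> (\int[P]_(t in C) (f t)%:E = P (E `&` C))%E].

(* Versions are unique up to null sets, so that the choice of pF is
   immaterial. *)
Definition cond_independent (M : choiceType) d (T : measurableType d)
    (R : realType) (P : probability T R) d' (S : measurableType d')
    (F : set (set T)) (xi : M -> T -> S) : Prop :=
  exists pF : set T -> T -> R,
    (forall E, measurable E -> is_cond_prob P F E (pF E)) /\
    forall (J : {fset M}) (B : M -> set S),
      (forall a, a \in J -> measurable (B a)) ->
      {ae P, forall t, pF (\bigcap_(a in [set` J]) xi a @^-1` B a) t =
                       \prod_(a <- J) pF (xi a @^-1` B a) t}.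

(* Main.v *)
(* Fix [a] and a Borel set [B], and let [p] be a nonnegative version of
   P(xi_a in B | xi_b, b <> a). On path space, [p] is invariant under the
   stabilizer G_a, by uniqueness of conditional probabilities. An event
   [p in Y] is approximated by events depending on finitely many
   coordinates b <> a. Since the orbits of G_a off [a] are infinite, such a
   finite set of coordinates can be moved off any prescribed finite set by an
   element of G_a, which leaves [p in Y] unchanged; hence [p in Y] is a tail
   event modulo null sets. So [p] is tail-measurable, i.e., xi_a is independent
   of (xi_b, b <> a) over the tail sigma-field, and conditional independence of
   the whole family follows by induction on the number of variables. *)
Require Import Defs.
From HB Require Import structures.
From mathcomp Require Import all_boot all_order all_algebra finmap.
From mathcomp Require Import all_classical all_reals all_analysis.
From mathcomp Require Import measurable_realfun.

Set Implicit Arguments.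
Unset Strict Implicit.
Unset Printing Implicit Defensive.

Import Order.TTheory GRing.Theory Num.Theory.

Local Open Scope classical_set_scope.
Local Open Scope ring_scope.

(** * Moving finite sets off finite sets by a group with infinite orbits *)

(* P. M. Neumann's separation lemma. If the element [g] given by induction
   sends [b] to a point [e] of [D], compose with the inverse of an element of
   [H] sending [c] to [e], where [c] is a point of the orbit of [b] not in
   [D]. *)
Lemma infinite_orbits_separation (M : choiceType) (H : set (M -> M))
    (Hcomp : forall g h, H g -> H h -> H (g \o h))
    (Hid : H id)
    (Hinv : forall g, H g -> exists2 h, H h & cancel g h)
    (s D : seq M) :
  (forall b, b \in s -> infinite_set (orbit_of H b)) ->
  exists2 g, H g & forall b, b \in s -> g b \notin D.
Proof.
elim: s D => [|b s IHs] D infH; first by exists id.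
have [c [k Hk kb] cD] : exists2 c, orbit_of H b c & c \notin D.
  apply: contrapT => nc; apply: (infH b (mem_head b s)).
  apply: (sub_finite_set _ (finite_seq D)) => c Hc /=.
  by apply: contraT => cD; case: nc; exists c.
(* For [e] in the orbit of [c], [h e] is an element of [H] sending [c] to [e]; for every other [e]
   the identity serves as a default. *)
have hex e : exists h, H h /\ ((exists2 g, H g & g c = e) -> h c = e).
  have [[g Hg gc]|nH] := pselect (exists2 g, H g & g c = e); first by exists g.
  by exists id; split.
have /(@boolp.choice _ _ _)[h hP] := hex.
(* Besides [D], the images of [D] under [h e], for [e] in [D], are avoided: if [g b] falls on such
   an [e], composing with the inverse of [h e] still keeps the points of [s] off [D]. *)
have [g Hg gs] := IHs (D ++ flatten [seq [seq h e x | x <- D] | e <- D])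
  (fun x xs => infH x (@mem_behead _ (b :: s) x xs)).
have [gbD|gbD] := boolP (g b \in D); last first.
  exists g => // x; rewrite inE => /predU1P[->//|xs].
  by have := gs x xs; rewrite mem_cat negb_or => /andP[].
have [Hh hgb] := hP (g b).
have [h' Hh' hK] := Hinv _ Hh.
(* As [c] is in the orbit of [b], so is [b] in that of [c]; hence [h (g b)] does send [c] to [g b],
   and its inverse takes [g b] back to [c], outside [D]. *)
have hc : h (g b) c = g b.
  apply: hgb; have [k' Hk' kK] := Hinv _ Hk.
  by exists (g \o k'); [exact: Hcomp|rewrite -kb /= kK].
exists (h' \o g); first exact: Hcomp.
move=> x; rewrite inE => /predU1P[->|xs] /=; first by rewrite -hc hK.
have := gs x xs; rewrite mem_cat negb_or => /andP[_]; apply: contra => h'gx.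
apply/flattenP; exists [seq h (g b) x | x <- D]; first exact: map_f.
(* [Hinv] yields left inverses; the left inverse of [h'] turns out to be [h (g b)], so that [h'] is
   a two-sided inverse. *)
have [h'' Hh'' h''K] := Hinv _ Hh'.
suff -> : g x = h (g b) (h' (g x)) by exact: map_f.
have h''E y : h'' y = h (g b) y by rewrite -{1}(hK y) h''K.
by rewrite -h''E h''K.
Qed.

(** * Closure properties of sigma-fields *)

Lemma sigma_algebra_setU (T : Type) (F : set (set T)) (A B : set T) :
  sigma_algebra setT F -> F A -> F B -> F (A `|` B).
Proof.
by move=> [F0 _ FU] FA FB; rewrite -bigcup2E; apply: FU => -[|[|]].
Qed.

Lemma sigma_algebra_setI (T : Type) (F : set (set T)) (A B : set T) :
  sigma_algebra setT F -> F A -> F B -> F (A `&` B).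
Proof. by move=> /sigma_algebraP[]// _ _ _; exact. Qed.

Lemma sigma_algebra_setT (T : Type) (F : set (set T)) :
  sigma_algebra setT F -> F setT.
Proof. by move=> [F0 FC _]; rewrite -(setD0 setT); exact: FC. Qed.

Lemma sigma_algebra_bigcap_seq (T : Type) (I : choiceType) (F : set (set T))
    (s : seq I) (X : I -> set T) :
  sigma_algebra setT F -> (forall i, i \in s -> F (X i)) ->
  F (\bigcap_(i in [set` s]) X i).
Proof.
move=> sF FX; rewrite bigcap_seq big_seq; elim/big_ind: _ => //.
- exact: sigma_algebra_setT.
- by move=> A B; exact: sigma_algebra_setI.
Qed.

(** * Conditional probabilities given a sub-sigma-field *)

Section cond_prob.
Context d (T : measurableType d) (R : realType) (P : probability T R).
Variable F : set (set T).
Hypotheses (sF : sigma_algebra setT F) (FT : F `<=` measurable).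

Local Notation TF := (g_sigma_algebraType F).

Let measurableF : (measurable : set (set TF)) = F.
Proof. exact: measurable_g_measurableTypeE. Qed.

(** The identity, seen as a map to the coarser measurable space; the image of [P] under it is the
    restriction of [P] to [F]. *)
Definition coarsening (t : T) : TF := t.

Let measurable_coarsening : measurable_fun setT coarsening.
Proof. by move=> _ A mA; rewrite setTI; apply: FT; rewrite -measurableF. Qed.

Lemma measurable_fun_coarser (d' : measure_display) (Y : measurableType d')
  (f : T -> Y) : measurable_fun setT (f : TF -> Y) -> measurable_fun setT f.
Proof. by move=> mf; apply: (measurableT_comp mf measurable_coarsening). Qed.

Let cmfun : {mfun T >-> TF} := HB.pack coarsening
  (isMeasurableFun.Build _ _ _ _ _ measurable_coarsening).

Let PF : probability TF R := distribution P cmfun.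

Let integral_coarsening (h : TF -> \bar R) (D : set T) : F D ->
  measurable_fun setT h -> (forall x, 0 <= h x)%E ->
  (\int[PF]_(x in D) h x = \int[P]_(x in D) h x)%E.
Proof.
move=> FD mh h0; rewrite [LHS]ge0_integral_pushforward//.
  by rewrite measurableF.
exact: measurable_funTS.
Qed.

Let F_setT : F setT.
Proof. exact: sigma_algebra_setT. Qed.

(** Both functions are integrable for the restriction of [P] to [F], where equal integrals over all
    measurable sets force equality almost everywhere; a null set of the restriction is null for
    [P]. *)
Lemma ae_eq_coarser (g h : T -> R) :
  measurable_fun setT (g : TF -> R) -> measurable_fun setT (h : TF -> R) ->
  P.-integrable setT (EFin \o g) -> P.-integrable setT (EFin \o h) ->
  (forall C, F C ->
    \int[P]_(t in C) (g t)%:E = \int[P]_(t in C) (h t)%:E)%E ->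
  {ae P, forall t, g t = h t}.
Proof.
move=> mg mh ig ih gh.
have mgE : measurable_fun setT ((EFin \o g) : TF -> \bar R).
  exact/measurable_EFinP.
have mhE : measurable_fun setT ((EFin \o h) : TF -> \bar R).
  exact/measurable_EFinP.
have igF : PF.-integrable setT (EFin \o g).
  by apply: integrable_pushforward.
have [N [mN N0 subN]] : ae_eq PF setT (EFin \o g) (EFin \o h).
  apply: integral_ae_eq => // C _ mC.
  have FC : F C by rewrite -measurableF.
  have mCT := FT FC.
  rewrite !integral_pushforward//; [exact: gh|exact: integrableS ih|
    exact: integrableS ig].
exists N; split => //; first by apply: FT; rewrite -measurableF.
by move=> t /= ght; apply: subN => /= /(_ Logic.I) [].
Qed.

Lemma cond_prob_unique (E : set T) (g h : T -> R) :
  is_cond_prob P F E g -> is_cond_prob P F E h -> {ae P, forall t, g t = h t}.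
Proof.
move=> [mg ig gE] [mh ih hE]; apply: ae_eq_coarser => // C FC.
by rewrite gE// hE.
Qed.

Section trace.
Variables (E : set T) (mE : measurable E).

(** Its density with respect to the restriction of [P] to [F] is the conditional probability of
    [E]. *)
Definition trace_measure (C : set TF) : \bar R := P (E `&` C).

Let trace0 : trace_measure set0 = 0%E.
Proof. by rewrite /trace_measure setI0 measure0. Qed.

Let trace_ge0 C : (0 <= trace_measure C)%E.
Proof. exact: measure_ge0. Qed.

Let trace_sigma_additive : semi_sigma_additive trace_measure.
Proof.
move=> C mC tC mUC; rewrite /trace_measure setI_bigcupr.
have mEC i : measurable (E `&` C i).
  by apply: measurableI => //; apply: FT; rewrite -measurableF.
apply: measure_semi_sigma_additive => //.
  exact: trivIset_setIl.
exact: bigcup_measurable.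
Qed.

Let trace_fin : fin_num_fun trace_measure.
Proof.
move=> C mC; rewrite fin_num_measure//; apply: measurableI => //.
by apply: FT; rewrite -measurableF.
Qed.

HB.instance Definition _ := isMeasure.Build _ _ _ trace_measure
  trace0 trace_ge0 trace_sigma_additive.
HB.instance Definition _ :=
  Measure_isFinite.Build _ _ _ trace_measure trace_fin.

Let trace_dom : trace_measure `<< PF.
Proof.
apply/null_content_dominatesP => A /[!measurableF] FA PA0.
exact: (@subset_measure0 _ _ _ P _ _ (measurableI _ _ mE (FT FA)) (FT FA)
  (@subIsetr _ E A) PA0).
Qed.

Lemma integral_trace (h : TF -> \bar R) (D : set T) :
  F D -> measurable_fun setT h -> (forall x, 0 <= h x)%E ->
  (\int[trace_measure]_(x in D) h x = \int[P]_(x in E `&` D) h x)%E.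
Proof.
move=> FD mh h0; have mD := FT FD; have mDF : measurable (D : set TF).
  by rewrite measurableF.
have mhT : measurable_fun (setT : set T) (h : T -> \bar R).
  exact: measurable_fun_coarser mh.
transitivity
    (\int[pushforward (mrestr P mE) coarsening]_(x in (D : set TF)) h x)%E.
  apply: eq_measure_integral => A _ _.
  by rewrite /= /pushforward /mrestr/= setIC.
rewrite ge0_integral_pushforward//; last exact: measurable_funTS mh.
(* The restriction of [P] to [E] does not charge the complement of [E], so the domain shrinks to the
   part of [D] inside [E], where it agrees with [P]. *)
have mEC : measurable (~` E) by exact: measurableC.
have nullEC : mrestr P mE (~` E) = 0%E by rewrite /mrestr setICl measure0.
rewrite (ge0_negligible_integral mEC mD (measurable_funTS mhT) _ nullEC)//.
rewrite setDE setCK setIC; apply: eq_measure_integral => A _ AED.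
by rewrite /= /mrestr setIidl// => x /AED[].
Qed.

Let f := Radon_Nikodym_SigmaFinite.f trace_measure PF.

Let mf : measurable_fun setT f.
Proof.
exact: measurable_int (Radon_Nikodym_SigmaFinite.f_integrable trace_dom).
Qed.

Let f0 x : (0 <= f x)%E.
Proof. exact: Radon_Nikodym_SigmaFinite.f_ge0 trace_dom x. Qed.

Let fE : EFin \o (fine \o f) = f.
Proof.
apply/funext => x /=; rewrite fineK//.
exact: Radon_Nikodym_SigmaFinite.f_fin_num trace_dom x.
Qed.

Let cond_prob_RN : is_cond_prob P F E (fine \o f).
Proof.
split.
- by apply: measurableT_comp => //; exact: mf.
- rewrite fE; apply/integrableP; split; first exact: measurable_fun_coarser.
  have /integrableP[_] := Radon_Nikodym_SigmaFinite.f_integrable trace_dom.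
  rewrite integral_coarsening//.
  exact: measurableT_comp.
- move=> C FC; have -> : (fun t => ((fine \o f) t)%:E) = f by rewrite -[RHS]fE.
  have mC : measurable (C : set TF) by rewrite measurableF.
  rewrite -integral_coarsening//.
  by rewrite -(Radon_Nikodym_SigmaFinite.f_integral trace_dom mC).
Qed.

(** Radon-Nikodym: the derivative of [trace_measure] is nonnegative and finite everywhere, so its
    real-valued form is a version. *)
Lemma cond_prob_exists :
  exists2 g : T -> R, is_cond_prob P F E g & forall t, 0 <= g t.
Proof.
by exists (fine \o f); [exact: cond_prob_RN|move=> t; exact/fine_ge0].
Qed.

(* Both sides are the integral of [h] against the trace of [P] on [E],
   whose density with respect to [P] restricted to [F] is [q]. *)
Lemma integral_cond_prob_mul (h q : T -> R) (D : set T) :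
  measurable_fun setT (h : TF -> R) -> (forall t, 0 <= h t) ->
  is_cond_prob P F E q -> F D ->
  (\int[P]_(t in D) (h t * q t)%:E = \int[P]_(t in E `&` D) (h t)%:E)%E.
Proof.
move=> mh h0 qE FD.
have mD := FT FD; have mDF : measurable (D : set TF) by rewrite measurableF.
have mhE : measurable_fun setT ((EFin \o h) : TF -> \bar R).
  exact/measurable_EFinP.
have hE0 x : (0 <= (EFin \o h) x)%E by rewrite lee_fin.
have mhf : measurable_fun setT ((fun t => (h t)%:E * f t)%E : TF -> \bar R).
  exact: emeasurable_funM.
(* By uniqueness [q] may be replaced by the Radon-Nikodym derivative [f], for which the change of
   measure formula is available. *)
transitivity (\int[P]_(t in D) ((h t)%:E * f t))%E.
  apply: ae_eq_integral => //.
  - apply: measurable_funTS; apply/measurable_EFinP.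
    apply: (@measurable_fun_coarser _ _ (fun t => h t * q t)).
    by case: qE => mq _ _; exact: measurable_funM.
  - by apply: measurable_funTS; exact: measurable_fun_coarser mhf.
  - have := cond_prob_unique qE cond_prob_RN; apply: filterS => t /= -> _.
    by rewrite EFinM -[X in (_ * X)%E]/((EFin \o (fine \o f)) t) fE.
rewrite -(integral_trace FD mhE hE0) -integral_coarsening//; last first.
  by move=> x; exact: mule_ge0 (hE0 x) (f0 x).
apply: Radon_Nikodym_SigmaFinite.change_of_variables => //.
exact: measurable_funTS.
Qed.

End trace.

End cond_prob.

(** The integral of [p * q] over [D] in [F] is that of [p] over the part of [D] in [C], by
    [integral_cond_prob_mul]. The last hypothesis turns it into the probability of the intersection
    of [B], [C] and [D], which characterizes [w]. *)
Lemma cond_prob_setI d (T : measurableType d) (R : realType)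
    (P : probability T R) (F : set (set T)) (sF : sigma_algebra setT F)
    (FT : F `<=` measurable) (B C : set T) (p q w : T -> R) :
  measurable B -> measurable C ->
  is_cond_prob P F B p -> (forall t, 0 <= p t) ->
  is_cond_prob P F C q -> (forall t, 0 <= q t) ->
  is_cond_prob P F (B `&` C) w ->
  (forall D, F D -> \int[P]_(t in C `&` D) (p t)%:E = P (B `&` (C `&` D)))%E ->
  {ae P, forall t, w t = p t * q t}.
Proof.
move=> mB mC [mp ip pE] p0 qC q0 [mw iw wE] pC.
have [mq _ _] := qC.
have mpq : measurable_fun setT
    ((fun t => p t * q t) : g_sigma_algebraType F -> R).
  exact: measurable_funM.
have FsetT := sigma_algebra_setT sF.
have pqE D : F D ->
    (\int[P]_(t in D) (p t * q t)%:E = P (B `&` (C `&` D)))%E.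
  by move=> FD; rewrite (integral_cond_prob_mul sF FT mC)// pC.
apply: (ae_eq_coarser sF FT) => //; last first.
  by move=> D FD; rewrite wE// pqE// setIA.
(* The product is nonnegative and its total integral is a probability, hence finite. *)
apply/integrableP; split.
  by apply/measurable_EFinP; exact: measurable_fun_coarser mpq.
under eq_integral do rewrite /= ger0_norm ?mulr_ge0//.
rewrite pqE//; apply: le_lt_trans (ltry 1).
by apply: probability_le1; rewrite setIT; exact: measurableI.
Qed.

(** * Sigma-fields generated by subfamilies of the variables *)

Section sigma_gen.
Context (M T : Type) d (S : measurableType d).
Implicit Types (xi : M -> T -> S) (D : set M).

Lemma sigma_algebra_sigma_gen xi D : sigma_algebra setT (sigma_gen xi D).
Proof. exact: smallest_sigma_algebra. Qed.

Lemma sigma_gen_coord xi D a B : D a -> measurable B ->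
  sigma_gen xi D (xi a @^-1` B).
Proof.
by move=> Da mB; apply: sub_sigma_algebra; exists a => //; exists B => //;
  rewrite setTI.
Qed.

Lemma sigma_gen_sub xi D (X : set (set T)) : sigma_algebra setT X ->
  (forall a B, D a -> measurable B -> X (xi a @^-1` B)) ->
  sigma_gen xi D `<=` X.
Proof.
move=> sX DX; rewrite /sigma_gen; apply: smallest_sub => // _ [a Da [B mB <-]].
by rewrite setTI; exact: DX.
Qed.

Lemma sub_sigma_gen xi D1 D2 : D1 `<=` D2 ->
  sigma_gen xi D1 `<=` sigma_gen xi D2.
Proof.
move=> D12; apply: sigma_gen_sub; first exact: sigma_algebra_sigma_gen.
by move=> a B /D12 Da mB; exact: sigma_gen_coord.
Qed.

End sigma_gen.

Lemma sigma_gen_reindex (M N T : Type) d (S : measurableType d)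
    (xi : M -> T -> S) (g : N -> M) (D : set N) :
  sigma_gen (fun a => xi (g a)) D `<=` sigma_gen xi (g @` D).
Proof.
apply: sigma_gen_sub; first exact: sigma_algebra_sigma_gen.
move=> a B Da mB.
by apply: (@sigma_gen_coord _ _ _ _ _ _ (g a)) => //; exists a.
Qed.

Lemma preimage_sigma_gen (M T U : Type) d (S : measurableType d)
    (xi : M -> T -> S) (s : U -> T) (D : set M) (C : set T) :
  sigma_gen xi D C ->
  sigma_gen (fun a => xi a \o s) D (s @^-1` C).
Proof.
move=> DC; suff : sigma_gen xi D `<=`
    image_set_system setT s (sigma_gen (fun a => xi a \o s) D).
  by move=> /(_ C DC); rewrite /image_set_system /= setTI.
apply: sigma_gen_sub.
  exact/sigma_algebra_image/sigma_algebra_sigma_gen.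
move=> a B Da mB; rewrite /image_set_system /= setTI -comp_preimage.
exact: (@sigma_gen_coord _ _ _ _ (fun a => xi a \o s)).
Qed.

(** Converse of [preimage_sigma_gen]: pulling back along [s] is onto the sigma-field generated by
    the composed variables. *)
Lemma sigma_gen_comp (M T U : Type) d (S : measurableType d)
    (xi : M -> T -> S) (s : U -> T) (D : set M) (E : set U) :
  sigma_gen (fun a => xi a \o s) D E ->
  exists2 C, sigma_gen xi D C & E = s @^-1` C.
Proof.
suff : sigma_gen (fun a => xi a \o s) D `<=`
    preimage_set_system setT s (sigma_gen xi D).
  by move=> /[apply] -[C DC <-]; exists C => //; rewrite setTI.
apply: sigma_gen_sub.
  exact/sigma_algebra_preimage/sigma_algebra_sigma_gen.
move=> a B Da mB; exists (xi a @^-1` B); first exact: sigma_gen_coord.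
by rewrite setTI.
Qed.

Lemma sigma_gen_measurable d (T : measurableType d) (M : Type) d'
    (S : measurableType d') (xi : M -> T -> S) :
  (forall a, measurable_fun setT (xi a)) ->
  forall D, sigma_gen xi D `<=` measurable.
Proof.
move=> mxi D.
apply: sigma_gen_sub (sigma_algebra_measurable _) _ => a B _ mB.
by rewrite -[X in measurable X]setTI; exact: mxi.
Qed.

(** * Approximation of events in probability *)

Section approximation.
Context d (T : measurableType d) (R : realType) (P : probability T R).

Lemma measurable_setY (A B : set T) :
  measurable A -> measurable B -> measurable (A `+` B).
Proof.
by move=> mA mB; rewrite setY_def; apply: measurableU; exact: measurableD.
Qed.

Lemma measure_setY_triangle (A B C : set T) :
  measurable A -> measurable B -> measurable C ->
  (P (A `+` C) <= P (A `+` B) + P (B `+` C))%E.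
Proof.
move=> mA mB mC.
have mAB := measurable_setY mA mB; have mBC := measurable_setY mB mC.
apply: (le_trans _ (measureU2 _ mAB mBC)).
rewrite le_measure ?inE//; [exact: measurable_setY|exact: measurableU|].
move=> t [] [] /=; have [] := pselect (B t); tauto.
Qed.

(** Borel-Cantelli: choose [C n] in [F] with errors below the summable sequence 1 / 2^(n+1). The
    upper limit of the [C n] is in [F] and differs from [E] only inside the upper limit of the
    symmetric differences, a null set. *)
Lemma approx_modulo_null (F : set (set T)) (E : set T) :
  sigma_algebra setT F -> F `<=` measurable -> measurable E ->
  (forall e : R, 0 < e -> exists2 C, F C & (P (E `+` C) < e%:E)%E) ->
  modulo_null P F E.
Proof.
move=> sF FT mE approx; split => //.
have e0 n : 0 < 1 / (2 ^ n.+1)%:R :> R by rewrite divr_gt0// ltr0n expn_gt0.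
have /(@boolp.choice _ _ _)[C CP] : forall n : nat, exists C,
    F C /\ (P (E `+` C) < (1 / (2 ^ n.+1)%:R)%:E)%E.
  by move=> n; have [C] := approx _ (e0 n); exists C.
have FC n : F (C n) by have [] := CP n.
have mC n : measurable (C n) by exact: FT.
have mEC n : measurable (E `+` C n) by exact: measurable_setY.
exists (lim_sup_set C).
  rewrite -(@sigma_algebra_id _ setT F sF).
  apply: (@bigcapT_measurable _ (g_sigma_algebraType F)) => n.
  apply: (@bigcup_measurable _ (g_sigma_algebraType F)) => k _.
  by rewrite /measurable/= sigma_algebra_id.
have mlim : measurable (lim_sup_set C).
  by apply: bigcapT_measurable => n; exact: bigcup_measurable.
have lim0 : P (lim_sup_set (fun n => E `+` C n)) = 0%E.
  apply: lim_sup_set_cvg0 => //; apply: le_lt_trans (ltry 1).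
  apply: le_trans (epsilon_trick0 xpredT ler01).
  by apply: lee_nneseries => // n _; apply: ltW; have [] := CP n.
apply: (subset_measure0 _ _ _ lim0).
- exact: measurable_setY.
- by apply: bigcapT_measurable => n; exact: bigcup_measurable.
- move=> t [[Et nC]|[Ct nE]] n _.
    have [k Ck] : exists k, forall j, (k <= j)%N -> ~ C j t.
      apply: contrapT => nk; apply: nC => k _; apply: contrapT => nCk.
      by apply: nk; exists k => j kj Cj; apply: nCk; exists j.
    exists (maxn n k); first exact: leq_maxl.
    by left; split => //; apply: Ck; exact: leq_maxr.
  by have [k nk Ck] := Ct n Logic.I; exists k => //; right.
Qed.

(* The sets that can be approximated by cylinders form a sigma-field. *)
Lemma sigma_gen_approx (M : Type) d' (S : measurableType d')
    (xi : M -> T -> S) (D : set M) (E : set T) (e : R) :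
  (forall a, measurable_fun setT (xi a)) -> sigma_gen xi D E -> 0 < e ->
  exists A C, [/\ finite_set A, A `<=` D, sigma_gen xi A C &
    (P (E `+` C) < e%:E)%E].
Proof.
move=> mxi DE e0.
have mgen := sigma_gen_measurable mxi.
pose K := [set X | measurable X /\ forall r : R, 0 < r ->
  exists A C, [/\ finite_set A, A `<=` D, sigma_gen xi A C &
    (P (X `+` C) < r%:E)%E]].
suff KD : sigma_gen xi D `<=` K by have [_ KE] := KD _ DE; exact: KE.
have K0 : K set0.
  split => // r r0; exists set0, set0; split => //.
    by have [] := sigma_algebra_sigma_gen xi set0.
  by rewrite setYK measure0 lte_fin.
have KC X : K X -> K (~` X).
  move=> [mX KX]; split; first exact: measurableC.
  move=> r r0; have [A [C [fA AD AC XC]]] := KX r r0.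
  exists A, (~` C); split => //.
    by rewrite -setTD; have [_ + _] := sigma_algebra_sigma_gen xi A; apply.
  suff -> : ~` X `+` ~` C = X `+` C by [].
  by apply/seteqP; split => t []/= [Xt Ct]; [right|left|right|left];
    split => //; exact: contrapT.
have KU X Y : K X -> K Y -> K (X `|` Y).
  move=> [mX KX] [mY KY]; split; first exact: measurableU.
  move=> r r0; have r20 : 0 < r / 2 by rewrite divr_gt0.
  have [A [C [fA AD AC XC]]] := KX _ r20.
  have [A' [C' [fA' AD' AC' YC']]] := KY _ r20.
  exists (A `|` A'), (C `|` C'); split.
  - by rewrite finite_setU.
  - by rewrite subUset.
  - apply: (sigma_algebra_setU (sigma_algebra_sigma_gen xi (A `|` A'))).
      by apply: (sub_sigma_gen _ AC); exact: subsetUl.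
    by apply: (sub_sigma_gen _ AC'); exact: subsetUr.
  - have mC := mgen _ _ AC; have mC' := mgen _ _ AC'.
    rewrite (splitr r) EFinD; apply: le_lt_trans (lteD XC YC').
    have mXC := measurable_setY mX mC; have mYC' := measurable_setY mY mC'.
    apply: (le_trans _ (measureU2 _ mXC mYC')).
    rewrite le_measure ?inE//.
    + by apply: measurable_setY; exact: measurableU.
    + by apply: measurableU; exact: measurable_setY.
    + by move=> t []/= []; tauto.
have KUn (X : (set T)^nat) n :
    (forall i, K (X i)) -> K (\big[setU/set0]_(i < n) X i).
  by move=> KX; elim/big_ind: _ => // Y Z; exact: KU.
apply: sigma_gen_sub; last first.
  move=> a B Da mB; split.
    by apply: (mgen [set a]); exact: sigma_gen_coord.
  move=> r r0; exists [set a], (xi a @^-1` B); split => //.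
  - by move=> _ ->.
  - exact: sigma_gen_coord.
  - by rewrite setYK measure0 lte_fin.
split => //; first by move=> X KX; rewrite setTD; exact: KC.
move=> X KX; have mX n : measurable (X n) by case: (KX n).
have mU : measurable (\bigcup_n X n) by exact: bigcupT_measurable.
split => // r r0; have r20 : 0 < r / 2 by rewrite divr_gt0.
(* [Y n] is what the first [n] sets miss of the union. A point of [X k] is gone from [Y k.+1], so
   the [Y n] decrease to the empty set, and by continuity from above a finite union is close enough
   to the whole. *)
pose Y n := \bigcup_n X n `\` \big[setU/set0]_(i < n) X i.
have mY n : measurable (Y n).
  by apply: measurableD => //; exact: bigsetU_measurable.
have [n Yn] : exists n, (P (Y n) < (r / 2)%:E)%E.
  apply: contrapT => nY.
  have Y0 : \bigcap_n Y n = set0.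
    apply/seteqP; split => // t Yt.
    have [[k _ Xk] _] := Yt 0 Logic.I.
    have [_] := Yt k.+1 Logic.I; apply.
    by rewrite -bigcup_mkord; exists k => /=.
  have Ydec : nonincreasing_seq Y.
    by move=> i j ij; apply/subsetPset; apply: setDS; exact: subset_bigsetU.
  have := nonincreasing_cvg_mu (le_lt_trans (probability_le1 P (mY 0)) (ltry 1))
    mY (bigcapT_measurable mY) Ydec.
  rewrite Y0 measure0 => PY0.
  have : ((r / 2)%:E <= 0 :> \bar R)%E.
    rewrite -(cvg_lim _ PY0)//.
    apply: lime_ge; first by apply/cvg_ex; exists 0%E.
    by apply: nearW => n; rewrite leNgt; apply/negP => Yn; apply: nY; exists n.
  by rewrite lee_fin leNgt r20.
have [mV KV] := KUn X n KX.
have [A [C [fA AD AC VC]]] := KV _ r20.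
exists A, C; split => //.
apply: le_lt_trans (measure_setY_triangle mU mV (mgen _ _ AC)) _.
rewrite [in ltRHS](splitr r) EFinD; apply: lteD => //.
suff -> : \bigcup_n X n `+` \big[setU/set0]_(i < n) X i = Y n by [].
rewrite setY_def [X in _ `|` X](_ : _ = set0) ?setU0//.
apply/seteqP; split => // t []; rewrite -bigcup_mkord => -[k _ Xk] nX.
by apply: nX; exists k.
Qed.

End approximation.

(** * Sigma-fields modulo null sets *)

Section modulo_null.
Context d (T : measurableType d) (R : realType) (P : probability T R).
Implicit Types (F : set (set T)) (C : set T).

Lemma sub_modulo_null F : F `<=` measurable -> F `<=` modulo_null P F.
Proof.
by move=> FT C FC; split; [exact: FT|exists C => //; rewrite setYK measure0].
Qed.

(** Complements have the same symmetric difference, and that of two countable unions lies in the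
    union of the termwise ones, which is null. *)
Lemma sigma_algebra_modulo_null F : sigma_algebra setT F -> F `<=` measurable ->
  sigma_algebra setT (modulo_null P F).
Proof.
move=> [F0 FC FU] FT; split; first exact: sub_modulo_null.
- move=> C [mC [C' FC' CC']]; split; first exact: measurableD.
  exists (setT `\` C'); first exact: FC.
  suff -> : (setT `\` C) `+` (setT `\` C') = C `+` C' by [].
  by apply/seteqP; split => t [] [] /=; rewrite ?setTD /=;
    have [] := pselect (C t); have [] := pselect (C' t); tauto.
- move=> C mnC.
  have mC n : measurable (C n) by case: (mnC n).
  have /(@boolp.choice _ _ _)[C' CP] : forall n, exists C',
      F C' /\ P (C n `+` C') = 0%E.
    by move=> n; have [_ [C' FC' CC']] := mnC n; exists C'.
  have mC' n : measurable (C' n) by apply: FT; case: (CP n).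
  split; first exact: bigcupT_measurable.
  exists (\bigcup_n C' n); first by apply: FU => n; case: (CP n).
  have mCC' n : measurable (C n `+` C' n) by exact: measurable_setY.
  have CC'0 : P (\bigcup_n (C n `+` C' n)) = 0%E.
    apply/negligibleP; first exact: bigcupT_measurable.
    apply: negligible_bigcup => n; apply/negligibleP => //.
    by case: (CP n).
  apply: (subset_measure0 _ _ _ CC'0); [|exact: bigcupT_measurable|].
    by apply: measurable_setY; exact: bigcupT_measurable.
  move=> t [] [] [n _ Cn] nC; exists n => //; [left|right]; split => // Cn';
    by apply: nC; exists n.
Qed.

(** Removing the null symmetric difference from either domain leaves the intersection of the two. *)
Lemma integral_setY0 C C' (f : T -> \bar R) :
  measurable C -> measurable C' -> P (C `+` C') = 0%E ->
  measurable_fun setT f -> (forall t, 0 <= f t)%E ->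
  (\int[P]_(t in C) f t = \int[P]_(t in C') f t)%E.
Proof.
move=> mC mC' CC' mf f0; have mN := measurable_setY mC mC'.
rewrite (ge0_negligible_integral mN mC (measurable_funTS mf) _ CC')//.
rewrite (ge0_negligible_integral mN mC' (measurable_funTS mf) _ CC')//.
congr (integral _ _ _); apply/seteqP; split => t [] + /not_orP[] /=;
  have [] := pselect (C t); have [] := pselect (C' t); tauto.
Qed.

Lemma measureI_setY0 X C C' : measurable X ->
  measurable C -> measurable C' -> P (C `+` C') = 0%E ->
  P (X `&` C) = P (X `&` C').
Proof.
move=> mX mC mC' CC'; rewrite -!integral_indic//.
apply: integral_setY0 => //; exact/measurable_EFinP.
Qed.

Lemma is_cond_prob_modulo_null F E (f : T -> R) C : F `<=` measurable ->
  measurable E -> is_cond_prob P F E f -> (forall t, 0 <= f t) ->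
  modulo_null P F C -> (\int[P]_(t in C) (f t)%:E = P (E `&` C))%E.
Proof.
move=> FT mE [_ /integrableP[mf _] fE] f0 [mC [C' FC' CC']].
have mC' := FT _ FC'.
have f0E t : (0 <= (EFin \o f) t)%E by rewrite lee_fin.
rewrite (integral_setY0 mC mC' CC' mf f0E).
by rewrite fE// (measureI_setY0 mE mC mC').
Qed.

End modulo_null.

(** * The tail sigma-field *)

Section tail.
Context d (T : measurableType d) (R : realType) (P : probability T R).
Context (M : Type) d' (S : measurableType d') (xi : M -> T -> S).
Hypothesis mxi : forall a, measurable_fun setT (xi a).

Lemma sigma_algebra_tail : sigma_algebra setT (tail_sigma P xi).
Proof.
have sA A := sigma_algebra_modulo_null P (sigma_algebra_sigma_gen xi (~` A))
  (@sigma_gen_measurable _ _ _ _ _ _ mxi (~` A)).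
split; first by move=> A _; have [] := sA A.
- by move=> C tC A fA; have [_ + _] := sA A; apply; exact: tC.
- by move=> C tC A fA; have [_ _] := sA A; apply => n; exact: tC.
Qed.

Lemma tail_measurable : tail_sigma P xi `<=` measurable.
Proof. by move=> C /(_ set0 (finite_set0 _))[]. Qed.

End tail.

(** * Transport of conditional probabilities along a map *)

(** Change of variables along [s]. It is used for the shifts of path space, and for the map sending
    a sample point to its path. *)
Lemma is_cond_prob_comp d (T : measurableType d) d' (U : measurableType d')
    (R : realType) (P : probability T R) (Q : probability U R) (s : T -> U)
    (F : set (set T)) (G : set (set U)) (E : set T) (E' : set U) (f : U -> R) :
  sigma_algebra setT G -> G `<=` measurable -> F `<=` measurable ->
  (forall C, G C -> F (s @^-1` C)) ->
  (forall C, F C -> exists2 C', G C' & C = s @^-1` C') ->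
  (forall C, G C -> P (s @^-1` C) = Q C) ->
  (forall C, G C -> P (E `&` s @^-1` C) = Q (E' `&` C)) ->
  (forall u, 0 <= f u) -> is_cond_prob Q G E' f ->
  is_cond_prob P F E (f \o s).
Proof.
move=> sG GU FT GF FG PQ PQE f0 [mf /integrableP[mfU foo] fE].
have mG : (measurable : set (set (g_sigma_algebraType G))) = G.
  exact: measurable_g_measurableTypeE.
have ms : measurable_fun setT (s : T -> g_sigma_algebraType G).
  by move=> _ C; rewrite mG setTI => GC; apply: FT; exact: GF.
have mfE : measurable_fun setT ((EFin \o f) : g_sigma_algebraType G -> \bar R).
  exact/measurable_EFinP.
have fs C : G C ->
    (\int[P]_(t in s @^-1` C) (f (s t))%:E = \int[Q]_(u in C) (f u)%:E)%E.
  move=> GC.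
  have mC : measurable (C : set (g_sigma_algebraType G)) by rewrite mG.
  have := @ge0_integral_pushforward _ _ _ _ _ _ ms P C (EFin \o f) mC
    (measurable_funTS mfE).
  have f0E : {in C, forall u, (0 <= (EFin \o f) u)%E}.
    by move=> u _; rewrite lee_fin.
  move=> /(_ f0E) /= <-.
  (* The image of [P] under [s] and the restriction of [Q] are the same measure on [G]. *)
  have mco : measurable_fun setT (@coarsening _ _ G : U -> _).
    by move=> _ X; rewrite mG setTI => GX; exact: GU.
  have := @ge0_integral_pushforward _ _ _ _ _ _ mco Q C (EFin \o f) mC
    (measurable_funTS mfE) f0E.
  move=> /= <-; apply: eq_measure_integral => X + _; rewrite mG => GX.
  exact: PQ.
have GT := sigma_algebra_setT sG.
split.
- move=> _ Y mY; rewrite setTI comp_preimage; apply: sub_sigma_algebra.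
  apply: GF; rewrite -mG -[X in measurable X]setTI; exact: mf.
- apply/integrableP; split.
    by apply: (measurableT_comp mfE ms).
  under eq_integral do rewrite /= ger0_norm//.
  rewrite -[X in integral _ X _](preimage_setT s) fs//.
  by under eq_integral do rewrite -(ger0_norm (f0 _)).
- by move=> C FC; have [C' GC' ->] := FG C FC; rewrite fs// fE// PQE.
Qed.

(** * Stabilizer invariance and tail measurability *)

Section shift.
Context (M : choiceType) (G : set (M -> M)) (hG : permutation_group G) (a : M).
Hypothesis horb :
  forall b, b != a -> infinite_set (orbit_of (stabilizer G a) b).
Context d (T : measurableType d) (R : realType) (P : probability T R).
Context d' (S : measurableType d') (xi : M -> T -> S).
Hypothesis mxi : forall b, measurable_fun setT (xi b).
Context (s : (M -> M) -> T -> T).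
Hypothesis sE : forall g b, xi b \o s g = xi (g b).
Hypothesis Ps : forall g C, G g -> sigma_gen xi setT C ->
  P (s g @^-1` C) = P C.

Let preimage_shift g D C : sigma_gen xi D C ->
  sigma_gen xi (g @` D) (s g @^-1` C).
Proof.
move=> /(preimage_sigma_gen (s := s g)) sC; apply: sigma_gen_reindex.
rewrite (_ : (fun b => _) = fun b => xi b \o s g)//.
by apply/funext => b; rewrite sE.
Qed.

Let shiftC1 g : stabilizer G a g -> g @` (~` [set a]) = ~` [set a].
Proof.
move=> [Gg ga]; have [gb _ _ _] := hG; have [h gK hK] := gb _ Gg.
apply/seteqP; split => [_ [b ba <-] /= gba|b ba].
  by apply: ba; rewrite /= -(gK b) gba -{1}ga gK.
by exists (h b) => [/= hb|]; [apply: ba; rewrite /= -(hK b) hb|rewrite hK].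
Qed.

Let sigma_gen_shift g C : stabilizer G a g -> sigma_gen xi (~` [set a]) C ->
  exists2 C', sigma_gen xi (~` [set a]) C' & C = s g @^-1` C'.
Proof.
move=> sg.
have : sigma_gen xi (~` [set a]) `<=`
    sigma_gen (fun b => xi b \o s g) (~` [set a]).
  apply: sigma_gen_sub; first exact: sigma_algebra_sigma_gen.
  move=> b B; rewrite -{1}(shiftC1 sg) => -[c ca <-] mB; rewrite -sE.
  exact: (@sigma_gen_coord _ _ _ _ (fun b => xi b \o s g)).
by move=> /[apply] /sigma_gen_comp.
Qed.

Let separation (A0 A : set M) :
  finite_set A0 -> finite_set A -> A0 `<=` ~` [set a] ->
  exists2 g, stabilizer G a g & g @` A0 `<=` ~` A.
Proof.
move=> /finite_seqP[s0 ->] /finite_seqP[s1 ->] A0a.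
have [gb Gid Gcomp Ginv] := hG.
have [||||g sg gA] :=
  @infinite_orbits_separation M (stabilizer G a) _ _ _ s0 s1.
- by move=> g h [Gg ga] [Gh ha]; split; [exact: Gcomp|rewrite /= ha].
- by split.
- move=> g [Gg ga]; have [h gK hK] := gb _ Gg; exists h => //.
  by split; [exact: Ginv gK hK|rewrite -{1}ga gK].
- by move=> b /A0a /eqP; exact: horb.
- by exists g => // _ [b /gA /negP bA <-].
Qed.

Lemma cond_prob_tail_measurable (B : set S) (p : T -> R) : measurable B ->
  is_cond_prob P (sigma_gen xi (~` [set a])) (xi a @^-1` B) p ->
  (forall t, 0 <= p t) ->
  forall Y, measurable Y -> tail_sigma P xi (p @^-1` Y).
Proof.
move=> mB pB p0 Y mY.
set F := sigma_gen xi (~` [set a]) in pB.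
have sF : sigma_algebra setT F by exact: sigma_algebra_sigma_gen.
have FT : F `<=` measurable by exact: sigma_gen_measurable.
have FpY : F (p @^-1` Y).
  case: pB => mp _ _; have := mp measurableT Y mY.
  by rewrite setTI /measurable/= sigma_algebra_id.
(* The shift by [g] preserves the measure, maps [F] onto itself by preimages, and fixes the event on
   [xi a] because [g a = a]. So [p] and its shift are versions of the same conditional
   probability. *)
have inv g : stabilizer G a g -> P (p @^-1` Y `+` s g @^-1` (p @^-1` Y)) = 0%E.
  move=> sg; have [Gg ga] := sg.
  have FsF C : F C -> F (s g @^-1` C).
    by move=> FC; rewrite /F -(shiftC1 sg); exact: preimage_shift.
  have pg : is_cond_prob P F (xi a @^-1` B) (p \o s g).
    apply: is_cond_prob_comp pB => //.
    - by move=> C; exact: sigma_gen_shift.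
    - by move=> C FC; apply: Ps => //; exact: sub_sigma_gen FC.
    - move=> C FC; rewrite -{1}ga -sE comp_preimage -preimage_setI Ps//.
      apply: (sigma_algebra_setI (sigma_algebra_sigma_gen _ _)).
        exact: sigma_gen_coord.
      exact: sub_sigma_gen FC.
  have [N [mN N0 subN]] := cond_prob_unique sF FT pB pg.
  apply: (subset_measure0 _ mN _ N0).
    by apply: measurable_setY; apply: FT => //; exact: FsF.
  move=> t tY; apply: subN => /= pt.
  by case: tY => /= -[]; rewrite -pt.
move=> A fA; apply: approx_modulo_null.
- exact: sigma_algebra_sigma_gen.
- exact: sigma_gen_measurable.
- exact: FT.
(* [C] depends on finitely many coordinates in [A0], all different from [a]; some [g] fixing [a]
   moves [A0] off [A], and the shifted [C] is then generated by coordinates outside [A]. *)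
move=> e e0; have [A0 [C [fA0 A0a A0C XC]]] := sigma_gen_approx P mxi FpY e0.
have [g sg gA] := separation fA0 fA A0a; have [Gg ga] := sg.
exists (s g @^-1` C); first by apply: (sub_sigma_gen gA); exact: preimage_shift.
have mX : measurable (p @^-1` Y) by exact: FT.
have msg D X : sigma_gen xi D X -> measurable (s g @^-1` X).
  by move=> /preimage_shift /(sigma_gen_measurable mxi); apply.
(* Go through the shifted event on [p]: its distance to the original is zero by [inv], and its
   distance to the shifted [C] is that of the unshifted pair. *)
apply: le_lt_trans (measure_setY_triangle P mX (msg _ _ FpY) (msg _ _ A0C)) _.
rewrite inv// add0e.
suff -> : P (s g @^-1` (p @^-1` Y) `+` s g @^-1` C) = P (p @^-1` Y `+` C) by [].
rewrite -[RHS](Ps Gg)//.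
have sT := sigma_algebra_sigma_gen xi setT.
have TX : sigma_gen xi setT (p @^-1` Y) by exact: sub_sigma_gen FpY.
have TC : sigma_gen xi setT C by exact: sub_sigma_gen A0C.
have [_ CT _] := sT.
have TD (X Z : set T) : sigma_gen xi setT X -> sigma_gen xi setT Z ->
    sigma_gen xi setT (X `\` Z).
  move=> ? ?; rewrite setDE; apply: (sigma_algebra_setI sT) => //.
  by rewrite -setTD; exact: CT.
by apply: (sigma_algebra_setU sT); exact: TD.
Qed.

End shift.

(** * One variable given the others: passage to path space and back *)

Lemma cond_prob_coord_tail (M : choiceType) (G : set (M -> M))
    (hG : permutation_group G) (a : M)
    (horb : forall b, b != a -> infinite_set (orbit_of (stabilizer G a) b))
    d (T : measurableType d) (R : realType) (P : probability T R)
    d' (S : measurableType d') (xi : M -> T -> S) (B : set S) :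
  (forall b, measurable_fun setT (xi b)) ->
  invariant_distribution G P xi -> measurable B ->
  exists f : T -> R, [/\ forall t, 0 <= f t,
    is_cond_prob P (sigma_gen xi (~` [set a])) (xi a @^-1` B) f &
    is_cond_prob P (tail_sigma P xi) (xi a @^-1` B) f].
Proof.
move=> mxi hinv mB.
pose coord (b : M) (x : M -> S) := x b.
pose gen := \bigcup_(b in setT) preimage_set_system setT (coord b) measurable.
pose Om := g_sigma_algebraType gen.
pose Xi (t : T) : Om := fun b => xi b t.
have mOm : (measurable : set (set Om)) = sigma_gen coord setT by [].
have mcoord b : measurable_fun setT (coord b : Om -> S).
  by move=> _ C mC; rewrite setTI mOm; exact: sigma_gen_coord.
have mXi : measurable_fun setT Xi.
  move=> _ C; rewrite mOm setTI => /(preimage_sigma_gen (s := Xi)).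
  exact: (sigma_gen_measurable mxi).
pose mfXi : {mfun T >-> Om} := HB.pack Xi (isMeasurableFun.Build _ _ _ _ _ mXi).
pose mu : probability Om R := distribution P mfXi.
(* The original space need not carry maps realizing [G]; on path space, reindexing does, and
   invariance of the distribution says that it preserves [mu]. *)
pose s (g : M -> M) (x : Om) : Om := fun b => x (g b).
have mus g C : G g -> sigma_gen coord setT C -> mu (s g @^-1` C) = mu C.
  by move=> Gg mC; exact: (hinv g Gg C mC).
have sF := sigma_algebra_sigma_gen coord (~` [set a]).
have FT := @sigma_gen_measurable _ Om _ _ _ coord mcoord (~` [set a]).
have maB : measurable (coord a @^-1` B : set Om).
  by rewrite -[X in measurable X]setTI; exact: mcoord.
have [p pB p0] := cond_prob_exists mu sF FT maB.
have ptail := @cond_prob_tail_measurable _ _ hG _ horb _ Om _ mu _ _ coord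
  mcoord s (fun g b => erefl) mus B p mB pB p0.
have fB : is_cond_prob P (sigma_gen xi (~` [set a])) (xi a @^-1` B) (p \o Xi).
  apply: (@is_cond_prob_comp _ _ _ Om _ _ mu Xi) pB => //.
  - exact: sigma_gen_measurable.
  - by move=> C /(preimage_sigma_gen (s := Xi)).
  - by move=> C /(@sigma_gen_comp _ _ _ _ _ coord Xi).
exists (p \o Xi); split => //; first by move=> t; exact: p0.
(* The same function is a version over the tail field: it is tail-measurable since path-space tail
   events pull back to tail events, and each tail event is, up to a null set, generated by the
   variables other than [xi a]. *)
have [mf intf fE] := fB; split => //.
- move=> _ Y mY; rewrite setTI comp_preimage; apply: sub_sigma_algebra => A fA.
  have [mpY [E FE pYE]] := ptail Y mY A fA.
  split; first by rewrite -[X in measurable X]setTI; exact: (mXi measurableT).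
  by exists (Xi @^-1` E); [exact: (preimage_sigma_gen (s := Xi)) FE|exact: pYE].
- move=> C tC; apply: is_cond_prob_modulo_null fB _ _ => //.
  + exact: sigma_gen_measurable.
  + by rewrite -[X in measurable X]setTI; exact: mxi.
  + by move=> t; exact: p0.
  + exact: (tC [set a] (finite_set1 a)).
Qed.

(** * Conditional independence by induction on the number of variables *)

Lemma cond_independent_tail (M : choiceType) (G : set (M -> M))
    (hG : permutation_group G)
    (horb : forall a b : M,
      b != a -> infinite_set (orbit_of (stabilizer G a) b))
    d (T : measurableType d) (R : realType) (P : probability T R)
    d' (S : measurableType d') (xi : M -> T -> S) :
  (forall a, measurable_fun setT (xi a)) ->
  invariant_distribution G P xi ->
  cond_independent P (tail_sigma P xi) xi.
Proof.
move=> mxi hinv.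
have sF := sigma_algebra_tail P mxi.
have FT := @tail_measurable _ _ _ P _ _ _ xi.
(* Nonnegative versions are chosen for all measurable events at once; other sets get the default
   0. *)
have /(@boolp.choice _ _ _)[pF pFP] : forall E, exists f : T -> R,
    measurable E -> is_cond_prob P (tail_sigma P xi) E f /\ forall t, 0 <= f t.
  move=> E; have [mE|nE] := pselect (measurable E); last by exists (fun=> 0).
  by have [f] := cond_prob_exists P sF FT mE; exists f.
have pFE E : measurable E -> is_cond_prob P (tail_sigma P xi) E (pF E).
  by move=> /pFP[].
have pF0 E t : measurable E -> 0 <= pF E t by move=> /pFP[].
exists pF; split => // J B mB.
have {mB} : forall a, a \in enum_fset J -> measurable (B a) by [].
have : uniq (enum_fset J) by exact: fset_uniq.
rewrite (_ : [set` J] = [set` enum_fset J])//.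
elim: (enum_fset J) => [_ _|a s IHs /= /andP[as_ us] mB].
  (* The empty intersection is the sure event, whose conditional probability is 1, the empty
     product. *)
  rewrite bigcap_seq big_nil.
  have p1 : is_cond_prob P (tail_sigma P xi) setT (fun=> 1).
    split; [exact: measurable_cst| |].
      exact: finite_measure_integrable_cst.
    by move=> C FC; rewrite integral_cst ?mul1e ?setTI//; exact: FT.
  have := cond_prob_unique sF FT (pFE _ measurableT) p1.
  by apply: filterS => t ->; rewrite big_nil.
have mBa : measurable (B a) by exact: mB (mem_head _ _).
have {}mB b : b \in s -> measurable (B b).
  by move=> bs; apply: mB; rewrite inE bs orbT.
set C := \bigcap_(b in [set` s]) xi b @^-1` B b in IHs *.
(* [s] does not contain [a], so [C] only involves the other variables. *)
have sC : sigma_gen xi (~` [set a]) C.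
  apply: sigma_algebra_bigcap_seq; first exact: sigma_algebra_sigma_gen.
  move=> b bs; apply: sigma_gen_coord (mB b bs) => /= ba.
  by rewrite -ba bs in as_.
have -> : \bigcap_(b in [set` a :: s]) xi b @^-1` B b = xi a @^-1` B a `&` C.
  by rewrite /C !bigcap_seq big_cons.
have mC : measurable C by exact: sigma_gen_measurable sC.
have mA : measurable (xi a @^-1` B a).
  by rewrite -[X in measurable X]setTI; exact: mxi.
have [f [f0 fA ftail]] := cond_prob_coord_tail hG (@horb a) mxi hinv mBa.
have FE := cond_prob_unique sF FT ftail (pFE _ mA).
have sD D : tail_sigma P xi D ->
    modulo_null P (sigma_gen xi (~` [set a])) (C `&` D).
  move=> /(_ _ (finite_set1 a)) nD.
  have smn := sigma_algebra_modulo_null P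
    (sigma_algebra_sigma_gen xi (~` [set a]))
    (@sigma_gen_measurable _ _ _ _ _ _ mxi _).
  apply: (sigma_algebra_setI smn) => //.
  by apply: sub_modulo_null => //; exact: sigma_gen_measurable.
(* Since [f] is also a version given all other variables, its integrals over the sets [C] meets [D],
   with [D] a tail event, are the required probabilities; this splits off the factor of [a]. *)
have := cond_prob_setI sF FT mA mC ftail f0 (pFE _ mC) (fun t => pF0 _ t mC)
  (pFE _ (measurableI _ _ mA mC)).
have hD D : tail_sigma P xi D ->
    (\int[P]_(t in C `&` D) (f t)%:E = P (xi a @^-1` B a `&` (C `&` D)))%E.
  move=> /sD; apply: is_cond_prob_modulo_null fA f0 => //.
  exact: sigma_gen_measurable.
move=> /(_ hD); move: FE (IHs us mB); apply: filterS3 => t fE CE ->.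
by rewrite big_cons fE CE.
Qed.

Theorem theorem1p3 (M : countType) (G : set (M -> M))
    (hG : permutation_group G)
    (horb : forall a b : M, b != a -> infinite_set (orbit_of (stabilizer G a) b))
    (R : realType) (d : measure_display) (T : measurableType d)
    (P : probability T R)
    (S : ptopologicalType) (hS : polish_space R S)
    (xi : M -> {RV P >-> borel S})
    (hinv : invariant_distribution G P xi) :
  cond_independent P (tail_sigma P xi) xi.
Proof.
apply: (@cond_independent_tail M G hG horb _ T R P _ (borel S)
  (fun a => xi a) _ hinv) => a.
exact: measurable_funP.
Qed.
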